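(* Suppose that the axiom $\mathsf{MA}(\aleph_1;\text{precaliber }\aleph_1)$ holds. Then there exists an atomistic $3$-ladder of cardinality $\aleph_2$.
   Context: The ambient theory is $\mathsf{ZFC}$; posets and lattices are nonempty. Forcing notions. Let $P$ be a poset. A subset $X\subseteq P$ is dense if for every $p\in P$ there is $x\in X$ with $x\le p$. A subset $X\subseteq P$ is centred if every finite subset of $X$ has a lower bound in $P$. $P$ has precaliber $\aleph_1$ if every uncountable subset of $P$ has an uncountable centred subset. A filter on $P$ is a nonempty, downward directed, upward closed subset of $P$. For a collection $\mathcal{D}$ of subsets of $P$, a subset $G$ of $P$ is $\mathcal{D}$-generic if $G\cap D\neq\varnothing$ for each dense $D\in\mathcal{D}$. The axiom $\mathsf{MA}(\aleph_1;\text{precaliber }\aleph_1)$ is the statement: for every poset $P$ of precaliber $\aleph_1$ and every collection $\mathcal{D}$ of subsets of $P$, if $|\mathcal{D}|\le\aleph_1$, then there exists a $\mathcal{D}$-generic filter on $P$. Ladders. A poset $P$ is lower finite if $\{x\in P: x\le p\}$ is finite for each $p\in P$. An element $x$ is a lower cover of $y$ if $x<y$ and there is no $z$ with $x<z<y$. For a positive integer $k$, a $k$-ladder is a lower finite lattice in which every element has at most $k$ lower covers; it has a least element $0$. An atom is an element having $0$ as a lower cover. A lattice with $0$ is atomistic if every element is a join of atoms ($0$ being the empty join). *)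

(* Defs.v *)
From mathcomp Require Import all_boot all_order.
From mathcomp Require Import boolp classical_sets functions cardinality.

Set Implicit Arguments.
Unset Strict Implicit.
Unset Printing Implicit Defensive.

Local Open Scope classical_set_scope.
Local Open Scope card_scope.

(* |A| = aleph_n.  aleph_(n+1) is the least cardinal above aleph_n.  Both
   the witness C of cardinality aleph_n and the competitors B range over
   subsets of A only: this loses nothing, since every cardinal at most |A| is
   the cardinal of a subset of A and cardinals are comparable. *)
Fixpoint has_card_aleph (n : nat) (T : Type) (A : set T) : Prop :=
  match n with
  | 0 => A #= [set: nat]
  | m.+1 => exists C : set T,
      [/\ C `<=` A, has_card_aleph m C, ~ (A #<= C) &
          forall B : set T, B `<=` A -> ~ (B #<= C) -> A #<= B]
  end.

Definition card_le_aleph (n : nat) (T : Type) (A : set T) : Prop :=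
  exists (U : Type) (W : set U), has_card_aleph n W /\ A #<= W.

Definition poset_dense d (P : porderType d) (X : set P) : Prop :=
  forall p : P, exists2 x, X x & (x <= p)%O.

Definition centred d (P : porderType d) (X : set P) : Prop :=
  forall F : set P, F `<=` X -> finite_set F -> has_lbound F.

Definition precaliber_aleph1 d (P : porderType d) : Prop :=
  forall X : set P, ~ countable X ->
    exists Y : set P, [/\ Y `<=` X, ~ countable Y & centred Y].

Definition poset_filter d (P : porderType d) (G : set P) : Prop :=
  [/\ G !=set0,
      forall x y, G x -> G y -> exists z, [/\ G z, (z <= x)%O & (z <= y)%O] &
      forall x y, G x -> (x <= y)%O -> G y].

Definition generic d (P : porderType d) (D : set (set P)) (G : set P) : Prop :=
  forall X : set P, D X -> poset_dense X -> (G `&` X) !=set0.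

Definition MA_aleph1_precaliber_aleph1 : Prop :=
  forall (d : Order.disp_t) (P : porderType d) (D : set (set P)),
    [set: P] !=set0 -> precaliber_aleph1 P -> card_le_aleph 1 D ->
    exists G : set P, poset_filter G /\ generic D G.

Definition lower_finite d (P : porderType d) : Prop :=
  forall p : P, finite_set [set x : P | (x <= p)%O].

Definition lower_cover d (P : porderType d) (x y : P) : Prop :=
  (x < y)%O /\ ~ (exists z : P, (x < z)%O /\ (z < y)%O).

Definition is_ladder (k : nat) d (L : latticeType d) : Prop :=
  [/\ [set: L] !=set0, lower_finite L &
      forall y : L, [set x : L | lower_cover x y] #<= `I_k].

Definition is_atom d (L : bLatticeType d) (x : L) : Prop :=
  lower_cover (\bot%O : L) x.

(* The set A may be empty, and then its join is the bottom element. *)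
Definition atomistic d (L : bLatticeType d) : Prop :=
  forall x : L, exists A : set L, A `<=` @is_atom d L /\ isLub A x.

(* Main.v *)
From HB Require Import structures.
Require Import Defs.
From mathcomp Require Import all_boot all_order.
From mathcomp Require Import boolp classical_sets functions cardinality.
From mathcomp Require Import wochoice.

(* A lower finite lattice K with at most aleph_1 elements is the union of a
   chain F of countable ideals, closed under countable unions.  For I in F let
   proj I x be the largest element of I below x.  Force with the finite
   meet-subsemilattices X of K that contain the bottom, have a top, are closed
   under every proj I, and in which every element has at most two lower covers.
   If Z is contained in I and contains X `&` I, then Z, X and the finite chain of
   all proj J s, where s bounds Z and X, form a condition.  This amalgamation,
   with a pressing-down argument along F, yields precaliber aleph_1 and density,
   so that MA gives a cofinal meet-subsemilattice A of K in which every element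
   has at most two lower covers.  Put on top of K a disjoint copy A' of A, with
   x <= a' iff x <= a for x in K: the lower covers of a' are a and the copies
   of the lower covers of a in A, and a' is the join of a and the new atom 0'.
   Hence a 3-ladder maximal under end-extension on a set of size aleph_2 has
   more than aleph_1 elements. *)

Set Implicit Arguments.
Unset Strict Implicit.
Unset Printing Implicit Defensive.

Import Order.TTheory.

Local Open Scope classical_set_scope.
Local Open Scope card_scope.

(** * Cardinals aleph_1 and aleph_2 *)

Lemma card_le_fun T U (A : set T) (B : set U) (u : U) : A #<= B ->
  exists2 f : T -> U, set_fun A B f & set_inj A f.
Proof.
elim/Ppointed: U => U in B u *; first by have := no u.
by move/pcard_leP/injfunPex.
Qed.

Lemma fun_card_le T U (A : set T) (B : set U) (f : T -> U) :
  set_fun A B f -> set_inj A f -> A #<= B.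
Proof.
move=> fAB fI; have [g] : $|{injfun A >-> B}| by apply/injfunPex; exists f.
exact: inj_card_le g.
Qed.

Lemma card_eq_ex T U (A : set T) (B : set U) (u : U) :
  A #= B -> exists f : T -> U, set_bij A B f.
Proof.
elim/Ppointed: U => U in B u *; first by have := no u.
by move/pcard_eqP/bijPex.
Qed.

Lemma has_card_aleph_eq n T U (A : set T) (B : set U) :
  A #= B -> has_card_aleph n A -> has_card_aleph n B.
Proof.
elim: n T U A B => [|n IH] T U A B AB /=.
  by apply: card_eq_trans; rewrite card_eq_sym.
have [u|nU] := pselect (exists u : U, True); last first.
  have B0 : B = set0 by apply/seteqP; split => // x; case: nU; exists x.
  move=> [C [_ _ nAC _]]; case: nAC; apply: card_le_trans (card_ge0 U C).
  by move: AB; rewrite B0 card_eq_le => /andP[].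
case: u => u _.
have [f [ff fi fs]] := card_eq_ex u AB.
move=> [C [CA nC nAC minC]].
have CfC : C #= f @` C.
  rewrite card_eq_sym; apply: inj_card_eq => x y /set_mem/CA xA /set_mem/CA yA.
  by apply: fi; apply/mem_set.
exists (f @` C); split.
- by move=> _ [x /CA xA <-]; apply: ff.
- exact: IH nC.
- by rewrite -(card_le_eql AB) -(card_le_eqr CfC).
move=> B' B'B B'C; rewrite -(card_le_eql AB).
have pre : A `&` f @^-1` B' #= B'.
  have {2}-> : B' = f @` (A `&` f @^-1` B').
    apply/seteqP; split => [y B'y|_ [x [_ ?] <-]//].
    by have [x Ax xy] := fs _ (B'B _ B'y); exists x => //; split=> //=; rewrite xy.
  rewrite card_eq_sym; apply: inj_card_eq => x y /set_mem[xA _] /set_mem[yA _].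
  by apply: fi; apply/mem_set.
rewrite -(card_le_eqr pre); apply: minC; first by move=> x [].
by rewrite (card_le_eql pre) (card_le_eqr CfC).
Qed.

Definition strict_well_order T (lt : T -> T -> Prop) :=
  [/\ forall x, ~ lt x x, forall y x z, lt x y -> lt y z -> lt x z,
      forall x y, [\/ lt x y, x = y | lt y x] &
      forall P : set T, P !=set0 -> exists2 x, P x & forall y, P y -> ~ lt y x].

Lemma strict_well_order_wf T (lt : T -> T -> Prop) :
  strict_well_order lt -> well_founded lt.
Proof.
move=> [_ _ _ ltmin] x; apply: contrapT => nx.
have [//|y ny miny] := ltmin [set x | ~ Acc lt x]; first by exists x.
by apply: ny; constructor => z zy; apply: contrapT => /miny.
Qed.

Lemma strict_well_order_exists T : exists lt : T -> T -> Prop, strict_well_order lt.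
Proof.
elim/Peq: T => T; have [R Rwo] := well_ordering_principle T.
have Rmin (P : set T) : P !=set0 ->
    exists2 x, P x & forall y, P y -> R x y.
  move=> [x0 Px0]; have [|x [[/set_mem Px xmin] _]] := Rwo [pred x | x \in P].
    by exists x0; rewrite !inE.
  by exists x => // y Py; apply: xmin; rewrite !inE.
have Rch : wo_chain R predT by apply: withinW.
have Rtot x y : R x y \/ R y x.
  by have /orP := wo_chainW Rch (x := x) (y := y) isT isT.
have Ranti x y : R x y -> R y x -> x = y.
  by move=> xy yx; apply: (wo_chain_antisymmetric Rch) => //; rewrite xy.
have Rtr y x z : R x y -> R y z -> R x z.
  move=> xy yz; have [t] := Rmin [set x; y; z] (ex_intro _ x (or_introl (or_introl erefl))).
  move=> [[->|->]|->] tmin.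
  - by apply: tmin; right.
  - by rewrite (Ranti x y) //; apply: tmin; left; left.
  - rewrite -(Ranti y z) //; by apply: tmin; left; right.
exists (fun x y => R x y /\ x <> y); split.
- by move=> x [].
- move=> y x z [xy nxy] [yz nyz]; split; first exact: Rtr yz.
  by move=> xz; apply: nxy; apply: Ranti => //; rewrite xz.
- move=> x y; have [->|nxy] := pselect (x = y); first by constructor 2.
  by have [] := Rtot x y; [constructor 1|constructor 3; split=> // /esym].
- move=> P /Rmin[x Px xmin]; exists x => // y /xmin xy [yx]; apply.
  exact: Ranti.
Qed.

Lemma Cantor U (u : U) : ~ ([set: set U] #<= [set: U]).
Proof.
move=> /(card_le_fun u)[f _ fI].
pose D := [set x | exists2 A : set U, f A = x & ~ A x].
have [DfD|nDfD] := pselect (D (f D)).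
  have [A fAD nA] := DfD; apply: nA.
  by rewrite (fI A D) ?inE.
by apply: (nDfD); exists D.
Qed.

Lemma successor_cardinal U (u : U) : exists (T : Type) (lt : T -> T -> Prop),
  [/\ strict_well_order lt, forall v, [set w | lt w v] #<= [set: U] &
      ~ ([set: T] #<= [set: U])].
Proof.
have [lt lt_wo] := strict_well_order_exists (set U).
have [irr tr tot ltmin] := lt_wo.
pose seg v := [set w | lt w v].
pose T := {v | seg v #<= [set: U]}.
have svalI (x y : T) : sval x = sval y -> x = y.
  by case: x y => [x ?] [y ?]; exact: eq_exist.
exists T, (fun x y => lt (sval x) (sval y)); split.
- split=> [x|y x z|x y|P [x0 Px0]]; [exact: irr|exact: tr| |].
    have [?|xy|?] := tot (sval x) (sval y); [exact: Or31| |exact: Or33].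
    by apply: Or32; apply: svalI.
  have [|_ [x Px <-] xmin] := ltmin (sval @` P); first by exists (sval x0), x0.
  by exists x => // y Py; apply: xmin; exists y.
- move=> [v vU] /=; apply: card_le_trans vU; apply: (@fun_card_le _ _ _ _ sval) => //.
  by move=> x y _ _; exact: svalI.
- have sub (A : set (set U)) : (forall v, A v -> seg v #<= [set: U]) ->
      A #<= [set: T].
    move=> AU; apply: card_le_trans (card_image_le (@sval _ _) _).
    by apply: subset_card_le => v Av; exists (exist _ v (AU _ Av)).
  have [allU|] := pselect (forall v, seg v #<= [set: U]).
    by move=> TU; apply: (Cantor u); apply: card_le_trans TU; apply: sub.
  move=> /existsNP ex; have [v vU vmin] := ltmin [set v | ~ (seg v #<= [set: U])] ex.
  move=> TU; apply: vU; apply: card_le_trans TU; apply: sub => w wv.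
  by apply: contrapT => /vmin.
Qed.

Lemma strict_well_order_embed T (lt : T -> T -> Prop) U V (B : set V) :
  strict_well_order lt -> (forall v, [set w | lt w v] #<= [set: U]) ->
  ~ (B #<= [set: U]) -> [set: T] #<= B.
Proof.
move=> lt_wo segU BU.
have [b0 _] : B !=set0.
  by apply/set0P/negP => /eqP B0; apply: BU; rewrite B0; exact: card_ge0.
have step x (F : forall y, lt y x -> V) :
    exists b, B b /\ forall y (yx : lt y x), F y yx <> b.
  apply: contrapT => none; apply: BU; apply: card_le_trans (segU x).
  pose G y := if pselect (lt y x) is left yx then F y yx else b0.
  apply: card_le_trans (card_image_le G _); apply: subset_card_le => b Bb.
  apply: contrapT => nb; apply: none; exists b; split=> // y yx Fb.
  apply: nb; exists y => //; rewrite /G; case: pselect => // yx'.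
  by rewrite (Prop_irrelevance yx' yx).
pose f := Fix (strict_well_order_wf lt_wo) (fun=> V) (fun x F => sval (cid (step x F))).
have fE x : B (f x) /\ forall y, lt y x -> f y <> f x.
  have -> : f x = sval (cid (step x (fun y _ => f y))).
    apply: Fix_eq => y F G FG.
    have FGE : F = G.
      apply: functional_extensionality_dep => z.
      exact: functional_extensionality_dep (FG z).
    by rewrite FGE.
  by case: cid => b /= [Bb nb]; split.
have [_ _ tot _] := lt_wo.
apply: (@fun_card_le _ _ _ _ f) => [x _|x y _ _ fxy]; first by have [] := fE x.
have [xy|//|yx] := tot x y.
- by have [_ /(_ _ xy)] := fE y.
- by have [_ /(_ _ yx)] := fE x; rewrite fxy.
Qed.

Lemma has_card_aleph_successor n T (lt : T -> T -> Prop) U :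
  strict_well_order lt -> (forall v, [set w | lt w v] #<= [set: U]) ->
  ~ ([set: T] #<= [set: U]) -> [set: U] #<= [set: T] ->
  has_card_aleph n [set: U] -> has_card_aleph n.+1 [set: T].
Proof.
move=> lt_wo segU TU UT nU.
have [t _] : [set: T] !=set0.
  by apply/set0P/negP => /eqP T0; apply: TU; rewrite T0; exact: card_ge0.
have [f _ fI] := card_le_fun t UT.
have UfU : [set: U] #= f @` [set: U] by rewrite card_eq_sym; exact: inj_card_eq.
exists (f @` [set: U]); split => //.
- exact: has_card_aleph_eq nU.
- by rewrite -(card_le_eqr UfU).
- by move=> B _; rewrite -(card_le_eqr UfU); exact: strict_well_order_embed segU.
Qed.

Lemma countableU T (A B : set T) : countable A -> countable B -> countable (A `|` B).
Proof.
move=> cA cB; rewrite -bigcup2E.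
by apply: bigcup_countable => // -[|[|n]] _ /=; rewrite ?countable0.
Qed.

Lemma aleph1_aleph2_exist : exists (T1 T2 : Type) (lt1 : T1 -> T1 -> Prop)
    (lt2 : T2 -> T2 -> Prop),
  [/\ strict_well_order lt1, strict_well_order lt2,
      forall v, countable [set w | lt1 w v], ~ countable [set: T1] &
      [/\ has_card_aleph 1 [set: T1], forall v, [set w | lt2 w v] #<= [set: T1],
          ~ ([set: T2] #<= [set: T1]) & has_card_aleph 2 [set: T2]]].
Proof.
have [T1 [lt1 [wo1 seg1 T1nat]]] := successor_cardinal 0.
have natT1 : [set: nat] #<= [set: T1].
  by apply/infiniteP => /finite_set_countable.
have T1_1 : has_card_aleph 1 [set: T1].
  by apply: (has_card_aleph_successor wo1 seg1) => //=; exact: card_eqxx.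
have [t1 _] : [set: T1] !=set0.
  by apply/infinite_setN0/infiniteP.
have [T2 [lt2 [wo2 seg2 T2T1]]] := successor_cardinal t1.
exists T1, T2, lt1, lt2; split => //; split => //.
apply: (has_card_aleph_successor wo2 seg2) => //.
apply: (strict_well_order_embed wo1 seg1) => // T2nat.
by apply: T2T1; apply: card_le_trans natT1.
Qed.

(* Removing a countable set N from T1 does not change its cardinality, so D
   embeds in T1 minus N; a countable complement of D would embed in N, hence
   T2 in T1. *)
Lemma complement_uncountable T1 (lt1 : T1 -> T1 -> Prop) T2 (D : set T2) :
  strict_well_order lt1 -> (forall v, countable [set w | lt1 w v]) ->
  ~ countable [set: T1] -> ~ ([set: T2] #<= [set: T1]) ->
  D #<= [set: T1] -> ~ countable (~` D).
Proof.
move=> wo1 seg1 T1nat T2T1 DT1 cDc; apply: T2T1.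
have natT1 : [set: nat] #<= [set: T1].
  by apply/infiniteP => /finite_set_countable.
have [t1 _] : [set: T1] !=set0 by apply/infinite_setN0/infiniteP.
have [e _ eI] := card_le_fun t1 natT1.
pose N := e @` [set: nat].
have T1N : [set: T1] #<= ~` N.
  apply: (strict_well_order_embed wo1 seg1) => // cNc; apply: T1nat.
  by rewrite -(setUv N); apply: countableU => //; exact: card_image_le.
have cDN : ~` D #<= N.
  by apply: card_le_trans cDc _; rewrite (card_le_eqr (inj_card_eq eI)).
have [h hf hI] := card_le_fun t1 (card_le_trans DT1 T1N).
have [k kf kI] := card_le_fun t1 cDN.
apply: (@fun_card_le _ _ _ _ (fun x => if pselect (D x) then h x else k x)) => //.
move=> x y _ _; case: pselect => Dx; case: pselect => Dy /= xy.
- by apply: hI; rewrite ?inE.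
- by have := hf _ Dx; rewrite xy => /(_ (kf _ Dy)).
- by have := hf _ Dy; rewrite -xy => /(_ (kf _ Dx)).
- by apply: kI; rewrite ?inE.
Qed.

(** * Forcing conditions and their amalgamation *)

Section Conditions.
Context {d : Order.disp_t} {L : bLatticeType d}.
Hypothesis finL : lower_finite L.
Local Open Scope order_scope.
Local Open Scope classical_set_scope.
Implicit Types (I J X Y Z : set L) (F : set (set L)) (x y z c : L).

Definition ideal I :=
  [/\ I \bot, forall x y, I y -> x <= y -> I x &
      forall x y, I x -> I y -> I (Order.join x y)].

Definition proj I x :=
  xget \bot [set p | [/\ I p, p <= x & forall z, I z -> z <= x -> z <= p]].

Lemma projP I x : ideal I ->
  [/\ I (proj I x), proj I x <= x & forall z, I z -> z <= x -> z <= proj I x].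
Proof.
move=> [I0 Ile Ijoin].
suff [p Pp] : exists p, [/\ I p, p <= x & forall z, I z -> z <= x -> z <= p].
  by rewrite /proj; case: xgetP => [q _ //|/(_ p)].
have /finite_seqP[s sE] := finL x.
have sP z : (z <= x) = (z \in s) :> Prop.
  by rewrite -[LHS]/([set y | y <= x] z) sE.
have xs z : z <= x -> z \in s by rewrite sP.
have sx z : z \in s -> z <= x by rewrite sP.
exists (\join_(z <- s | `[< I z >]) z); split.
- by apply: big_ind => [//|//|z /asboolP].
- by apply/joinsP_seq => z /sx.
- by move=> z Iz /xs zs; apply: joins_sup_seq => //; apply/asboolP.
Qed.

Lemma projE I x p : ideal I -> I p -> p <= x ->
  (forall z, I z -> z <= x -> z <= p) -> proj I x = p.
Proof.
move=> iI Ip px pmax; have [Iq qx qmax] := projP x iI.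
by apply/le_anti; rewrite pmax // qmax.
Qed.

Definition cover_in X y c :=
  [/\ X c, c < y & forall z, X z -> c < z -> ~ (z < y)].

Definition two_covers X y := exists a b, forall c, cover_in X y c -> c = a \/ c = b.

Lemma cover_in_eq X y c z : cover_in X y c -> X z -> c <= z -> z < y -> c = z.
Proof.
move=> [_ _ cmax] Xz cz zy; apply: contrapT => /eqP ncz.
by apply: (cmax z) => //; rewrite lt_neqAle ncz.
Qed.

Lemma two_covers_sub X Y y : X `<=` Y -> (forall c, cover_in Y y c -> X c) ->
  two_covers X y -> two_covers Y y.
Proof.
move=> XY YX [a [b ab]]; exists a, b => c Yc; apply: ab; split.
- exact: YX.
- by have [] := Yc.
- by move=> z /XY; have [_ _] := Yc; apply.
Qed.

Definition filtration F :=
  [/\ forall I, F I -> ideal I /\ countable I,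
      forall I J, F I -> F J -> I `<=` J \/ J `<=` I,
      forall C : set L, countable C -> exists2 I, F I & C `<=` I &
      forall I_ : nat -> set L, (forall n, F (I_ n)) -> F (\bigcup_n I_ n)].

Definition condition F X :=
  [/\ finite_set X, X \bot, forall x y, X x -> X y -> X (Order.meet x y),
      forall I x, F I -> X x -> X (proj I x) &
      (exists2 t, X t & forall x, X x -> x <= t) /\
      forall y, X y -> two_covers X y].

Definition amalgam F Z X s :=
  [set y | [\/ Z y, X y | exists2 J, F J & y = proj J s]].

Lemma amalgam_condition F I Z X s : filtration F -> F I ->
  condition F Z -> condition F X -> Z `<=` I -> X `&` I `<=` Z ->
  (forall z, Z z -> z <= s) -> (forall x, X x -> x <= s) ->
  condition F (amalgam F Z X s).
Proof.
move=> [Fideal Ftot Fcount _] FI [Zfin Z0 Zmeet Zproj [[tZ ZtZ maxZ] Zcov]]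
  [Xfin X0 Xmeet Xproj [[tX XtX maxX] Xcov]] ZI XIZ Zs Xs.
have iI := (Fideal _ FI).1.
have id J (FJ : F J) : ideal J by have [] := Fideal _ FJ.
have meetZX z x : Z z -> X x -> Z (Order.meet z x).
  move=> Zz Xx; have [Ip px pmax] := projP x iI.
  suff -> : Order.meet z x = Order.meet z (proj I x).
    by apply: Zmeet => //; apply: XIZ; split => //; apply: Xproj.
  apply/le_anti; rewrite !lexI !leIl /= (le_trans (leIr _ _) px) andbT.
  apply: pmax; last exact: leIr.
  by have [_ Ile _] := iI; apply: (Ile _ z); [exact: ZI|exact: leIl].
have meet_proj J y : F J -> y <= s -> Order.meet (proj J s) y = proj J y.
  move=> FJ ys; have [Jp ps pmax] := projP s (id _ FJ).
  apply/esym/projE; [exact: id| |exact: leIr|].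
    by have [_ Jle _] := id _ FJ; apply: (Jle _ _ Jp); exact: leIl.
  by move=> z Jz zy; rewrite lexI zy pmax // (le_trans zy).
have chain_le J y : F J -> y <= s -> proj J s <= y -> proj J s = proj J y.
  by move=> FJ ys py; rewrite -(meet_proj _ _ FJ ys); apply/esym/meet_idPl.
have projmono J K : F J -> F K -> J `<=` K -> proj J s <= proj K s.
  move=> FJ FK JK; have [_ _ pmax] := projP s (id _ FK).
  by have [Jp ps _] := projP s (id _ FJ); apply: pmax => //; exact: JK.
have totC J K : F J -> F K -> proj J s <= proj K s \/ proj K s <= proj J s.
  by move=> FJ FK; have [?|?] := Ftot _ _ FJ FK; [left|right]; apply: projmono.
have projs J : F J -> proj J s <= s by move=> /id /(projP s)[].
split.
- apply: sub_finite_set (_ : _ `<=` [set y | y <= s]) (finL s).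
  by move=> y [/Zs|/Xs|[J FJ ->]] //; exact: projs.
- by constructor 1.
- move=> x y [Zx|Xx|[J FJ ->]] [Zy|Xy|[K FK ->]].
  + by constructor 1; apply: Zmeet.
  + by constructor 1; apply: meetZX.
  + by constructor 1; rewrite meetC meet_proj ?Zs //; exact: Zproj.
  + by constructor 1; rewrite meetC; apply: meetZX.
  + by constructor 2; apply: Xmeet.
  + by constructor 2; rewrite meetC meet_proj ?Xs //; exact: Xproj.
  + by constructor 1; rewrite meet_proj ?Zs //; exact: Zproj.
  + by constructor 2; rewrite meet_proj ?Xs //; exact: Xproj.
  + by constructor 3; have [/meet_idPl ->|/meet_idPr ->] := totC _ _ FJ FK;
      [exists J|exists K].
- move=> J x FJ [Zx|Xx|[K FK ->]].
  + by constructor 1; exact: Zproj.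
  + by constructor 2; exact: Xproj.
  + constructor 3; rewrite -meet_proj //; last exact: projs.
    by have [/meet_idPl ->|/meet_idPr ->] := totC _ _ FJ FK; [exists J|exists K].
split.
  have [J FJ sJ] := Fcount [set s] (countable1 s).
  exists s; last by move=> y [/Zs|/Xs|[K FK ->]] //; exact: projs.
  constructor 3; exists J => //; apply/esym/projE => //; first exact: id.
  exact: sJ.
have down J x y : F J -> J y -> x <= y -> J x.
  by move=> /id[_ Jle _] Jy xy; exact: Jle xy.
move=> y Yy; have [Zy|nZy] := pselect (Z y).
  apply: two_covers_sub (Zcov y Zy); first by move=> z; constructor 1.
  move=> c [[//|Xc|[J FJ ->]] cy _].
    by apply: XIZ; split => //; apply: (down _ _ y) => //; [exact: ZI|exact: ltW].
  by rewrite (chain_le _ y) ?Zs ?ltW //; exact: Zproj.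
have [Xy|nXy] := pselect (X y).
  apply: two_covers_sub (Xcov y Xy); first by move=> z; constructor 2.
  move=> c Cc; have [[Zc|//|[J FJ ->]] cy _] := Cc; last first.
    by rewrite (chain_le _ y) ?Xs ?ltW //; exact: Xproj.
  have [Ip py pmax] := projP y iI; have Xp := Xproj _ _ FI Xy.
  rewrite (cover_in_eq Cc (z := proj I y)) //; first by constructor 2.
    by apply: pmax; [exact: ZI|exact: ltW].
  rewrite lt_neqAle py andbT; apply/eqP => pyE; apply: nZy.
  by rewrite -pyE; apply: XIZ.
have [//|//|[J FJ yE]] := Yy.
have ys : y <= s by rewrite yE; exact: projs.
have [Jy _ ymax] : [/\ J y, y <= s & forall z, J z -> z <= s -> z <= y].
  by rewrite yE; exact/projP/id.
(* Two covers of y on the chain coincide, so it is enough that at most one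
   cover e of y lies off the chain. *)
suff [e ce] : exists e, forall c, cover_in (amalgam F Z X s) y c ->
    c = e \/ exists2 K, F K & c = proj K s.
  have [[c Cc [K FK cE]]|nc] := pselect (exists2 c, cover_in (amalgam F Z X s) y c &
      exists2 K, F K & c = proj K s); last first.
    by exists e, e => c Cc; have [?|?] := ce _ Cc; [left|case: nc; exists c].
  exists c, e => c' Cc'; have [?|[K' FK' c'E]] := ce _ Cc'; [by right|left].
  have [Yc cy _] := Cc; have [Yc' c'y _] := Cc'.
  have [] := totC _ _ FK FK'; rewrite -cE -c'E => le.
    by rewrite (cover_in_eq Cc Yc').
  by rewrite (cover_in_eq Cc' Yc).
have [Iy|nIy] := pselect (I y).
  exists (proj J tZ) => c Cc; have [Yc cy _] := Cc.
  have Jc : J c by apply: (down _ _ y) => //; exact: ltW.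
  have [Zc|nZc] := pselect (Z c); last first.
    right; have [//|Xc|//] := Yc; case: nZc; apply: XIZ; split => //.
    by apply: (down _ _ y) => //; exact: ltW.
  left; have [Jp pt pmax] := projP tZ (id _ FJ); have Zp := Zproj _ _ FJ ZtZ.
  apply: cover_in_eq Cc _ _ _; [by constructor 1|by apply: pmax => //; exact: maxZ|].
  rewrite lt_neqAle ymax ?Zs // andbT; apply/eqP => pyE; apply: nZy.
  by rewrite -pyE.
have IJ : I `<=` J.
  by have [//|JI] := Ftot _ _ FI FJ; case: nIy; exact: JI.
exists (proj J tX) => c Cc; have [Yc cy _] := Cc.
have Jc : J c by apply: (down _ _ y) => //; exact: ltW.
have [Zc|Xc|] := Yc; [right|left|by right].
  have [Ip ps pmax] := projP s iI; exists I => //.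
  apply: cover_in_eq Cc _ _ _; [by constructor 3; exists I| |].
    by apply: pmax; [exact: ZI|exact: Zs].
  rewrite lt_neqAle ymax ?andbT //; last exact: IJ.
  by apply/eqP => pyE; apply: nIy; rewrite -pyE.
have [Jp pt pmax] := projP tX (id _ FJ); have Xp := Xproj _ _ FJ XtX.
apply: cover_in_eq Cc _ _ _; [by constructor 2|by apply: pmax => //; exact: maxX|].
rewrite lt_neqAle ymax ?Xs // andbT; apply/eqP => pyE; apply: nXy.
by rewrite -pyE.
Qed.

Lemma condition_restrict F I X : filtration F -> F I -> condition F X ->
  condition F (X `&` I).
Proof.
move=> [Fideal Ftot _ _] FI [Xfin X0 Xmeet Xproj [[t Xt maxX] Xcov]].
have iI := (Fideal _ FI).1; have [I0 Ile _] := iI.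
split.
- exact: finite_setIl.
- by [].
- by move=> x y [Xx Ix] [Xy Iy]; split; [exact: Xmeet|exact: Ile Ix (leIl _ _)].
- move=> J x FJ [Xx Ix]; split; first exact: Xproj.
  by have [_ px _] := projP x (Fideal _ FJ).1; exact: Ile px.
split.
  have [Ip pt pmax] := projP t iI.
  exists (proj I t); first by split=> //; exact: Xproj.
  by move=> x [Xx Ix]; apply: pmax => //; exact: maxX.
move=> y [Xy Iy]; have [a [b ab]] := Xcov y Xy; exists a, b => c [[Xc Ic] cy cmax].
apply: ab; split => // z Xz cz zy; apply: (cmax z) => //; split => //.
exact: Ile (ltW zy).
Qed.
End Conditions.

(** * Precaliber aleph_1 *)

Lemma finite_subset_directed T (C : set (set T)) (E : set T) :
  C !=set0 -> (forall A B, C A -> C B -> exists2 D, C D & A `<=` D /\ B `<=` D) ->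
  finite_set E -> E `<=` \bigcup_(A in C) A -> exists2 A, C A & E `<=` A.
Proof.
elim/Peq: T => T in C E * => -[A0 CA0] Cdir /finite_seqP[s ->].
elim: s => [|x s IH] sC; first by exists A0.
have [|A CA sA] := IH; first by move=> y ys; apply: sC; rewrite /= inE ys orbT.
have [B CB Bx] := sC x (mem_head _ _).
have [D CD [AD BD]] := Cdir _ _ CA CB; exists D => // y /=.
by rewrite inE => /orP[/eqP ->|/sA /AD//]; exact: BD.
Qed.

Section Precaliber.
Context {d : Order.disp_t} {L : bLatticeType d}.
Hypothesis finL : lower_finite L.
Local Open Scope order_scope.
Local Open Scope classical_set_scope.
Variable F : set (set L).
Hypothesis filF : filtration F.

(* Otherwise every U has a bound g U in F beyond which U is never attained, and
   the union of an omega-chain in F closed under g is a counterexample. *)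
Lemma press_down (CC : set (set L)) : CC `<=` condition F -> ~ countable CC ->
  exists U, forall I0, F I0 ->
    exists I X, [/\ F I, I0 `<=` I, CC X, ~ (X `<=` I) & X `&` I = U].
Proof.
move=> CCcond CCunc; apply: contrapT => /forallNP noU.
have [Fideal Ftot Fcount Fcup] := filF.
have /choice[g gP] : forall U, exists g, F g /\
    forall I X, F I -> g `<=` I -> CC X -> ~ (X `<=` I) -> X `&` I <> U.
  move=> U; apply: contrapT => /forallNP ng; apply: (noU U) => I0 FI0.
  apply: contrapT => nI; apply: (ng I0); split=> // I X FI I0I CX XI XIU.
  by apply: nI; exists I, X.
have /choice[next nextP] : forall I : set L, exists J, F I ->
    [/\ F J, I `<=` J & forall U, U `<=` I -> finite_set U -> g U `<=` J].
  move=> I; have [FI|nFI] := pselect (F I); last by exists I.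
  have [|J FJ subJ] := Fcount (I `|` \bigcup_(U in [set U | U `<=` I /\ finite_set U]) g U).
    apply: countableU; first exact: (Fideal _ FI).2.
    apply: bigcup_countable; first exact/countable_finite_subset/(Fideal _ FI).2.
    by move=> U _; apply: (Fideal _ (gP U).1).2.
  exists J => _; split => //; first by move=> x Ix; apply: subJ; left.
  by move=> U UI finU x gx; apply: subJ; right; exists U.
have [J0 FJ0 _] := Fcount set0 (countable0 _).
pose I_ n := iter n next J0.
have FI_ n : F (I_ n) by elim: n => //= n /nextP[].
have I_S n : I_ n `<=` I_ n.+1 by have [] := nextP _ (FI_ n).
have I_mono m n : (m <= n)%N -> I_ m `<=` I_ n.
  move=> /subnK <-; elim: (n - m)%N => //= k IH; exact: subset_trans IH (I_S _).
pose I := \bigcup_n I_ n; have FI : F I by exact: Fcup.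
have [X CX XI] : exists2 X, CC X & ~ (X `<=` I).
  apply: contrapT => nX; apply: CCunc.
  have := countable_finite_subset (Fideal _ FI).2; apply: sub_countable.
  apply: subset_card_le => X CX; split; last by have [] := CCcond _ CX.
  by apply: contrapT => XI; apply: nX; exists X.
have finXI : finite_set (X `&` I).
  by apply: finite_setIl; have [] := CCcond _ CX.
have [|||_ [n _ <-] UIn] := @finite_subset_directed _ (range I_) (X `&` I) _ _ finXI.
- by exists (I_ 0), 0.
- move=> _ _ [m _ <-] [n _ <-]; exists (I_ (maxn m n)); first by exists (maxn m n).
  by split; apply: I_mono; rewrite ?leq_maxl ?leq_maxr.
- by rewrite bigcup_image => x [].
have [_ gI] := gP (X `&` I); apply: (gI I X) => //.
have [_ _ /(_ _ UIn finXI)] := nextP _ (FI_ n).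
by move=> gsub x /gsub Ix; exists n.+1.
Qed.

Lemma uncountable_centred_subset (CC : set (set L)) :
  CC `<=` condition F -> ~ countable CC ->
  exists S, [/\ S `<=` CC, ~ countable S &
    forall E, E `<=` S -> finite_set E ->
      exists2 Z, condition F Z & forall X, E X -> X `<=` Z].
Proof.
move=> CCcond CCunc; have [U UP] := press_down CCcond CCunc.
have [Fideal Ftot Fcount _] := filF.
have Ucond : condition F U.
  have [J0 FJ0 _] := Fcount set0 (countable0 _).
  have [I [X [FI _ CX _ <-]]] := UP _ FJ0.
  by apply: condition_restrict => //; exact: CCcond.
(* Sets of members of CC on which amalgamation succeeds inside every I in F. *)
pose good S := S `<=` CC /\ forall E I, E `<=` S -> finite_set E -> F I ->
  U `<=` I -> (forall X, E X -> X `<=` I) ->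
  exists Z, [/\ condition F Z, U `<=` Z, Z `<=` I & forall X, E X -> X `<=` Z].
have good0 : good set0.
  split=> // E I E0 _ FI UI EI; exists U; split => // X /E0//.
have [S [[SCC Sgood] Smax]] : exists S, good S /\ forall S', S `<` S' -> ~ good S'.
  apply: Zorn_bigcup => C Cgood Ctot.
  have [C0|Cn0] := pselect (C !=set0); last first.
    suff -> : C = set0 by rewrite bigcup_set0.
    by apply/seteqP; split=> // x Cx; case: Cn0; exists x.
  split; first by move=> X [S /Cgood[SCC _] /SCC].
  move=> E I EC finE; have [|S CS ES] := finite_subset_directed C0 _ finE EC.
    by move=> A B CA CB; have [AB|BA] := Ctot _ _ CA CB; [exists B => //; split|exists A => //; split].
  by have [_] := Cgood _ CS; apply.
have maxgood X : CC X -> good (X |` S) -> S X.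
  move=> CX gX; apply: contrapT => nSX; apply: (Smax (X |` S)) => //.
  by split; [exact: subsetUr|move=> /(_ X (or_introl erefl))].
exists S; split => //; last first.
  move=> E ES finE; have [|I FI EI] := Fcount (U `|` \bigcup_(X in E) X).
    apply: countableU; first by apply: finite_set_countable; have [] := Ucond.
    apply: bigcup_countable; first exact: finite_set_countable.
    move=> X /ES/SCC/CCcond[finX _ _ _ _]; exact: finite_set_countable.
  have [||Z [Zc _ _ EZ]] := Sgood E I ES finE FI; last by exists Z.
  - by move=> x Ux; apply: EI; left.
  - by move=> X EX x Xx; apply: EI; right; exists X.
move=> cS; have [|I0 FI0 SI0] := Fcount (\bigcup_(X in S) X).
  apply: bigcup_countable => // X /SCC/CCcond[finX _ _ _ _].
  exact: finite_set_countable.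
have [I [X [FI I0I CX nXI XIU]]] := UP _ FI0.
have SI Y : S Y -> Y `<=` I by move=> SY x Yx; apply/I0I/SI0; exists Y.
suff SX : S X by apply: nXI; exact: SI.
apply: maxgood => //; split; first by move=> Y [->|/SCC].
move=> E I1 ES' finE FI1 UI1 EI1.
have [EX|nEX] := pselect (E X); last first.
  by apply: Sgood => // Y EY; have [YX|//] := ES' _ EY; case: nEX; rewrite -YX.
have II1 : I `<=` I1.
  have [//|I1I] := Ftot _ _ FI FI1.
  by case: nXI; exact: subset_trans (EI1 _ EX) I1I.
have [||||Z [Zc UZ ZI EZ]] := Sgood (E `\ X) I _ _ FI.
- by move=> Y [EY YX]; have [|//] := ES' _ EY.
- exact: finite_setD.
- by rewrite -XIU => x [].
- by move=> Y [EY YX]; apply: SI; have [|//] := ES' _ EY.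
have [tZ ZtZ maxZ] : exists2 t, Z t & forall x, Z x -> x <= t by have [_ _ _ _ []] := Zc.
have [tX XtX maxX] : exists2 t, X t & forall x, X x -> x <= t.
  by have [_ _ _ _ []] := CCcond _ CX.
have [iI1 _] := Fideal _ FI1; have [_ I1le I1join] := iI1.
pose s := Order.join tZ tX.
have I1s : I1 s by apply: I1join; [apply/II1/ZI|apply: EI1 XtX].
exists (amalgam F Z X s); split.
- apply: (@amalgam_condition _ _ finL _ I) => //; first exact: CCcond.
  + by rewrite XIU.
  + by move=> z /maxZ zt; exact: le_trans zt (leUl _ _).
  + by move=> z /maxX zt; exact: le_trans zt (leUr _ _).
- by move=> x /UZ; constructor 1.
- move=> x [/ZI/II1//|/(EI1 _ EX)//|[J FJ ->]].
  by have [_ ps _] := projP finL s (Fideal _ FJ).1; exact: I1le ps.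
- move=> Y EY; have [->|YX] := pselect (Y = X); first by move=> x; constructor 2.
  by move=> x Yx; constructor 1; apply: (EZ Y).
Qed.
End Precaliber.

(** * Generic meet-subsemilattices *)

Definition reverse_inclusion T (C : set (set T)) := {X : set T | C X}.

Section ReverseInclusion.
Variables (T : Type) (C : set (set T)).
Local Notation P := (reverse_inclusion C).
HB.instance Definition _ := gen_eqMixin P.
HB.instance Definition _ := gen_choiceMixin P.
Let le (X Y : P) : bool := `[< sval Y `<=` sval X >].

Let le_refl : reflexive le. Proof. by move=> X; apply/asboolP. Qed.

Let le_anti : antisymmetric le.
Proof.
move=> [X CX] [Y CY] /andP[/asboolP YX /asboolP XY].
by apply: eq_exist => /=; apply/seteqP.
Qed.

Let le_trans : transitive le.
Proof.
by move=> Y X Z /asboolP XY /asboolP YZ; apply/asboolP; exact: subset_trans XY.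
Qed.

HB.instance Definition _ := Order.Le_isPOrder.Build (Order.Disp tt tt) P
  le_refl le_anti le_trans.

Lemma reverse_inclusionE (X Y : P) : (X <= Y)%O <-> sval Y `<=` sval X.
Proof. by split => [/asboolP|XY] //; exact/asboolP. Qed.

End ReverseInclusion.

Section Generic.
Context {d : Order.disp_t} {L : bLatticeType d}.
Hypothesis finL : lower_finite L.
Local Open Scope order_scope.
Local Open Scope classical_set_scope.
Variable F : set (set L).
Hypothesis filF : filtration F.

Lemma condition_bot : condition F [set \bot].
Proof.
have [Fideal _ _ _] := filF.
split => //.
- by move=> x y -> ->; rewrite meetxx.
- move=> I x /Fideal[iI _] ->; apply: projE => //; first by case: iI.
split; first by exists \bot => // x ->.
by move=> y ->; exists \bot, \bot => c [->]; rewrite ltxx.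
Qed.

Lemma condition_dense k X : condition F X ->
  exists Y, [/\ condition F Y, X `<=` Y & exists2 y, Y y & k <= y].
Proof.
move=> cX; have [Fideal Ftot Fcount _] := filF.
have [finX _ _ _ [[t Xt maxX] _]] := cX.
have [I FI XI] := Fcount X (finite_set_countable finX).
pose s := Order.join t k; have [J FJ Js] := Fcount [set s] (countable1 s).
have Xs x : X x -> x <= s by move=> /maxX xt; exact: le_trans xt (leUl _ _).
exists (amalgam F X X s); split.
- by apply: (@amalgam_condition _ _ finL _ I) => // x [].
- by move=> x; constructor 1.
- exists s; last exact: leUr.
  constructor 3; exists J => //; apply/esym/projE => //; last exact: Js.
  exact: (Fideal _ FJ).1.
Qed.

Lemma cofinal_meet_subsemilattice :
  MA_aleph1_precaliber_aleph1 -> card_le_aleph 1 [set: L] ->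
  exists A : set L, [/\ A \bot, forall x y, A x -> A y -> A (Order.meet x y),
    forall x, exists2 y, A y & x <= y & forall y, A y -> two_covers A y].
Proof.
move=> MA [U [W [W1 LW]]].
pose P := reverse_inclusion (condition F).
pose D k := [set X : P | exists2 y, sval X y & k <= y].
have [|||G [[[X0 GX0] Gdir Gup] Ggen]] := MA _ P (range D).
- by exists (exist _ _ condition_bot).
- move=> CC uncCC; pose CCs := sval @` CC.
  have [|cCCs|S [SCC uncS SP]] := uncountable_centred_subset finL filF (CC := CCs).
  + by move=> _ [[X cX] _ <-].
  + apply: uncCC; apply: card_le_trans cCCs.
    apply: (@fun_card_le _ _ _ _ sval) => [X CX|[X ?] [Y ?] _ _ /= XY].
      by exists X.
    exact: eq_exist.
  exists [set X | CC X /\ S (sval X)]; split.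
  + by move=> X [].
  + move=> cS; apply: uncS; apply: card_le_trans cS.
    apply: card_le_trans (card_image_le (@sval _ _) _); apply: subset_card_le.
    by move=> X SX; have [Y CY YX] := SCC _ SX; exists Y => //; rewrite /= YX.
  + move=> E ES finE.
    have [||Z cZ ZP] := SP (sval @` E); last first.
    * exists (exist _ Z cZ) => X EX; apply/reverse_inclusionE => /=.
      by apply: ZP; exists X.
    * exact: finite_image.
    * by move=> _ [X /ES[_ ?] <-].
- exists U, W; split => //; apply: card_le_trans LW; exact: card_image_le.
have GD k : exists2 X, G X & exists2 y, sval X y & k <= y.
  have [||X [GX DX]] := Ggen (D k); last by exists X.
  - by exists k.
  - move=> [X cX]; have [Y [cY XY kY]] := condition_dense k cX.
    by exists (exist _ Y cY) => //; apply/reverse_inclusionE.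
pose A := \bigcup_(X in G) sval X.
have GA (E : set L) : finite_set E -> E `<=` A -> exists2 X, G X & E `<=` sval X.
  move=> finE EA; have [||||_ [X GX <-] EX] := @finite_subset_directed _ (sval @` G) E.
  - by exists (sval X0), X0.
  - move=> _ _ [X GX <-] [Y GY <-]; have [Z [GZ ZX ZY]] := Gdir _ _ GX GY.
    by exists (sval Z); [exists Z|split; exact/reverse_inclusionE].
  - by [].
  - by rewrite bigcup_image.
  - by exists X.
exists A; split.
- by exists X0 => //; have [] := svalP X0.
- move=> x y Ax Ay; have [||X GX XP] := GA [set x; y]; first exact: finite_set2.
    by move=> _ [->|->].
  exists X => //; have [_ _ Xmeet _ _] := svalP X.
  by apply: Xmeet; apply: XP; [left|right].
- by move=> x; have [X GX [y Xy xy]] := GD x; exists y => //; exists X.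
move=> y Ay; have [||X GX XP] := GA (A `&` [set x | x <= y]).
- exact/finite_setIr/finL.
- by move=> x [].
have [_ _ _ _ [_ Xcov]] := svalP X.
apply: two_covers_sub (Xcov y _).
- by move=> x Xx; exists X.
- by move=> c [Ac cy _]; apply: XP; split => //; exact: ltW.
- by apply: XP; split => //=.
Qed.
End Generic.

(** * Chains of countable ideals *)

Section FiltrationExists.
Context {d : Order.disp_t} {L : bLatticeType d}.
Hypothesis finL : lower_finite L.
Local Open Scope order_scope.
Local Open Scope classical_set_scope.

Definition generated_ideal (A : set L) :=
  [set x | exists2 E, E `<=` A /\ finite_set E &
    forall u, (forall y, E y -> y <= u) -> x <= u].

Lemma generated_idealP A : ideal (generated_ideal A).
Proof.
split.
- by exists set0; [split; [exact: sub0set|exact: finite_set0]|move=> u _; exact: le0x].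
- move=> x y [E EA Ey] xy; exists E => // u /Ey; exact: le_trans.
- move=> x y [E [EA finE] Ex] [E' [E'A finE'] Ey]; exists (E `|` E').
    by split; [rewrite subUset|rewrite finite_setU].
  move=> u Eu; rewrite leUx Ex ?Ey // => z Ez; apply: Eu; by [left|right].
Qed.

Lemma countable_generated_ideal A : countable A -> countable (generated_ideal A).
Proof.
move=> /countable_finite_subset cA.
have -> : generated_ideal A = \bigcup_(E in [set E | E `<=` A /\ finite_set E])
    [set x | forall u, (forall y, E y -> y <= u) -> x <= u].
  by apply/seteqP; split=> x [E]; exists E.
apply: bigcup_countable => // E [_ /finite_seqP[s ->]].
apply: finite_set_countable; apply: sub_finite_set (finL (\join_(x <- s) x)).
by move=> x /=; apply => y ys; exact: joins_sup_seq.
Qed.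

Lemma generated_ideal_mono A B : A `<=` B -> generated_ideal A `<=` generated_ideal B.
Proof.
move=> AB x [E [EA finE] Ex]; exists E => //; split => //.
exact: subset_trans AB.
Qed.

Lemma filtration_exists T (lt : T -> T -> Prop) : strict_well_order lt ->
  (forall v, countable [set w | lt w v]) -> ~ countable [set: T] ->
  [set: L] #<= [set: T] -> exists F : set (set L), filtration F.
Proof.
move=> [irr tr tot ltmin] segT uncT LT.
have [t _] : [set: T] !=set0.
  by apply/set0P/negP => /eqP T0; apply: uncT; rewrite T0.
have [r _ rI] := card_le_fun t LT.
have bounded (C : set T) : countable C -> exists w, forall v, C v -> lt v w.
  move=> cC; apply: contrapT => nw; apply: uncT.
  have -> : [set: T] = \bigcup_(v in C) ([set v] `|` [set w | lt w v]).
    apply/seteqP; split=> // w _; apply: contrapT => nCw; apply: nw; exists w => v Cv.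
    have [//|vw|wv] := tot v w; case: nCw; exists v => //; last by right.
    by left; rewrite /= vw.
  by apply: bigcup_countable => // v _; apply: countableU => //; exact: countable1.
pose below w := [set x : L | lt (r x) w].
have below_mono v w : ~ lt w v -> below v `<=` below w.
  move=> nwv x xv; have [vw|<-//|//] := tot v w.
  exact: tr xv vw.
exists (range (generated_ideal \o below)); split.
- move=> _ [w _ <-]; split; first exact: generated_idealP.
  apply: countable_generated_ideal.
  apply: card_le_trans (segT w); apply: (@fun_card_le _ _ _ _ r) => //.
  by move=> x y _ _; apply: rI; rewrite ?inE.
- move=> _ _ [v _ <-] [w _ <-].
  have [wv|nwv] := pselect (lt w v); [right|left];
    apply/generated_ideal_mono/below_mono => // vw.
  exact: (irr v (tr _ _ _ vw wv)).
- move=> C cC; have [|w Cw] := bounded (r @` C).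
    by apply: card_le_trans cC; exact: card_image_le.
  exists ((generated_ideal \o below) w); first by exists w.
  move=> x Cx; exists [set x]; last by move=> u; apply.
  by split; [move=> _ ->; apply: Cw; exists x|exact: finite_set1].
move=> I_ I_F; have /choice[w_ w_P] : forall n, exists w, (generated_ideal \o below) w = I_ n.
  by move=> n; have [w _ wI] := I_F n; exists w.
have [|w wub wmin] := ltmin [set w | forall n, ~ lt w (w_ n)].
  have [|w ww] := bounded (range w_).
    by apply: card_le_trans (card_image_le _ _) _; exact: countableP.
  by exists w => n wwn; apply: (irr w); apply: tr wwn _; apply: ww; exists n.
exists w => //; apply/seteqP; split => x /=; last first.
  by move=> [n _]; rewrite -w_P; exact/generated_ideal_mono/below_mono/wub.
move=> [E [Ew finE] Ex].
have [||||_ [n _ <-] En] := @finite_subset_directed _ (range (below \o w_)) E.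
- by exists ((below \o w_) 0), 0.
- move=> _ _ [m _ <-] [n _ <-].
  have [mn|nmn] := pselect (lt (w_ n) (w_ m)).
    exists ((below \o w_) m); first by exists m.
    split => //; apply: below_mono => nm; exact: irr (tr _ _ _ mn nm).
  exists ((below \o w_) n); first by exists n.
  by split => //; exact: below_mono.
- by [].
- rewrite bigcup_image => y /Ew yw; apply: contrapT => ny.
  apply: (wmin (r y)) => // n yn; apply: ny; by exists n.
by exists n => //; rewrite -w_P; exists E.
Qed.
End FiltrationExists.

(** * Ladder orders on subsets of a type *)

Section LadderOrders.
Variables (T : Type) (o : T).
Implicit Types (le : T -> T -> Prop).

Definition rel_cover le x y :=
  [/\ le x y, x <> y & forall z, le x z -> le z y -> z = x \/ z = y].

(* The carrier of the order is [set x | le x x]. *)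
Record ladder_order le := LadderOrder {
  lo_dom : forall x y, le x y -> le x x /\ le y y;
  lo_anti : forall x y, le x y -> le y x -> x = y;
  lo_trans : forall y x z, le x y -> le y z -> le x z;
  lo_bot : forall x, le x x -> le o x;
  lo_fin : forall y, finite_set [set x | le x y];
  lo_meet : forall x y, le x x -> le y y ->
    exists m, [/\ le m x, le m y & forall z, le z x -> le z y -> le z m];
  lo_dir : forall x y, le x x -> le y y -> exists u, le x u /\ le y u;
  lo_cover : forall y, exists a b c, forall x, rel_cover le x y -> [\/ x = a, x = b | x = c];
  lo_atom : forall x y, le y x ->
    (forall p, rel_cover le o p -> le p x -> le p y) -> y = x;
  lo_oo : le o o
}.

Definition end_extension le le' := forall y, le y y -> forall x, le' x y <-> le x y.

Lemma rel_cover_end_extension le le' y :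
  (forall x z, le x z -> le x x) -> end_extension le le' -> le y y ->
  forall x, rel_cover le' x y <-> rel_cover le x y.
Proof.
move=> dom ext yy x; split=> [[/(ext _ yy) xy nxy xymax]|[xy nxy xymax]]; split => //.
- by move=> z xz zy; apply: xymax; apply/ext => //; exact: dom zy.
- exact/ext.
- by move=> z xz /(ext _ yy) zy; apply: xymax => //; apply/(ext _ (dom _ _ zy)).
Qed.

Lemma ladder_order_bot : ladder_order (fun x y => x = o /\ y = o).
Proof.
split=> //.
- by move=> x y [-> ->].
- by move=> x y [-> ->].
- by move=> y x z [-> _] [_ ->].
- by move=> x [-> _].
- by move=> y; apply: sub_finite_set (finite_set1 o) => x [->].
- by move=> x y [-> _] [-> _]; exists o.
- by move=> x y [-> _] [-> _]; exists o.
- by move=> y; exists o, o, o => x [[-> _] _ _]; constructor 1.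
- by move=> x y [-> ->].
Qed.

Lemma ladder_order_union (C : set (T -> T -> Prop)) :
  C !=set0 -> C `<=` ladder_order -> total_on C end_extension ->
  let leC x y := exists2 le, C le & le x y in
  ladder_order leC /\ forall le, C le -> end_extension le leC.
Proof.
move=> [le0 Cle0] CL Ctot leC.
have ext le : C le -> end_extension le leC.
  move=> Cle y yy x; split=> [[le1 Cle1 xy]|xy]; last by exists le.
  have [H|H] := Ctot _ _ Cle Cle1; first exact/H.
  by apply/(H y) => //; have [] := lo_dom (CL _ Cle1) xy.
have dom x y : leC x y -> leC x x /\ leC y y.
  by move=> [le Cle xy]; have [? ?] := lo_dom (CL _ Cle) xy; split; exists le.
have dom2 x y : leC x x -> leC y y -> exists le, [/\ C le, le x x & le y y].
  move=> [le1 C1 xx] [le2 C2 yy].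
  have [H|H] := Ctot _ _ C1 C2; [exists le2|exists le1]; split => //; exact/H.
split => //; split => //.
- move=> x y [le Cle xy] yx; apply: (lo_anti (CL _ Cle) xy); apply/(ext _ Cle) => //.
  by have [] := lo_dom (CL _ Cle) xy.
- move=> y x z xy [le Cle yz]; exists le => //; apply: (lo_trans (CL _ Cle) _ yz).
  by apply/(ext _ Cle) => //; have [] := lo_dom (CL _ Cle) yz.
- by move=> x [le Cle xx]; exists le => //; exact: lo_bot (CL _ Cle) _ xx.
- move=> y; have [[le Cle yy]|nyy] := pselect (leC y y); last first.
    by apply: sub_finite_set (finite_set0 _) => x /dom[].
  apply: sub_finite_set (lo_fin (CL _ Cle) y) => x /=; exact: (ext _ Cle _ yy x).1.
- move=> x y xx yy; have [le [Cle xx' yy']] := dom2 _ _ xx yy.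
  have [m [mx my mmax]] := lo_meet (CL _ Cle) xx' yy'.
  exists m; split; [exists le|exists le|] => // z zx zy; exists le => //.
  by apply: mmax; apply/(ext _ Cle).
- move=> x y xx yy; have [le [Cle xx' yy']] := dom2 _ _ xx yy.
  by have [u [xu yu]] := lo_dir (CL _ Cle) xx' yy'; exists u; split; exists le.
- move=> y; have [[le Cle yy]|nyy] := pselect (leC y y); last first.
    by exists y, y, y => x [/dom[]].
  have [a [b [c abc]]] := lo_cover (CL _ Cle) y; exists a, b, c => x xy.
  apply: abc; apply/(rel_cover_end_extension _ (ext _ Cle)) => //.
  by move=> u v /(lo_dom (CL _ Cle))[].
- move=> x y yx atm; have [_ [le Cle xx]] := dom _ _ yx.
  have yx' : le y x by apply/(ext _ Cle).
  have [yy _] := lo_dom (CL _ Cle) yx'.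
  apply: (lo_atom (CL _ Cle) yx') => p op px; apply/(ext _ Cle) => //; apply: atm.
    apply/(rel_cover_end_extension _ (ext _ Cle)) => //.
      by move=> u v /(lo_dom (CL _ Cle))[].
    by have [] := lo_dom (CL _ Cle) px.
  by exists le.
- by exists le0 => //; exact: lo_oo (CL _ Cle0).
Qed.

Lemma ladder_order_extend le (A : set T) (g : T -> T) :
  ladder_order le -> (forall x, A x -> le x x) -> A o ->
  (forall x y m, A x -> A y -> le m x -> le m y ->
    (forall z, le z x -> le z y -> le z m) -> A m) ->
  (forall x, le x x -> exists2 a, A a & le x a) ->
  (forall y, A y -> exists a b, forall c, A c -> le c y -> c <> y ->
    (forall z, A z -> le c z -> le z y -> z = c \/ z = y) -> c = a \/ c = b) ->
  (forall a b, A a -> A b -> g a = g b -> a = b) ->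
  (forall a, A a -> ~ le (g a) (g a)) ->
  exists le', [/\ ladder_order le', end_extension le le' & exists2 x, le' x x & ~ le x x].
Proof.
move=> lo Adom Ao Ameet Acof Acov gI gnew.
have oo : le o o := Adom o Ao.
pose dom (a : T) (m : bool) := le a a /\ (m -> A a).
(* The new order is induced by the product of le and bool: emb a false is the
   old element a, and emb a true its copy. *)
pose emb (a : T) (m : bool) := if m then g a else a.
have embI a m b n : dom a m -> dom b n -> emb a m = emb b n -> a = b /\ m = n.
  case: m; case: n => -[aa Aa] [bb Ab] /=; rewrite /emb => E.
  - by split => //; apply: gI => //; [exact: Aa|exact: Ab].
  - by have := gnew a (Aa isT); rewrite E.
  - by have := gnew b (Ab isT); rewrite -E.
  - by [].
pose le' x y := exists a m b n,
  [/\ x = emb a m, y = emb b n, dom a m, dom b n & le a b /\ (m -> n)].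
have le'E a m b n : dom a m -> dom b n -> le' (emb a m) (emb b n) <-> le a b /\ (m -> n).
  move=> da db; split; last by move=> ?; exists a, m, b, n.
  move=> [a' [m' [b' [n' [/embI Ea /embI Eb da' db' ab]]]]].
  by have [-> ->] := Ea da da'; have [-> ->] := Eb db db'.
have domle a m b n : dom a m -> dom b n -> le a b -> (m -> n) -> le' (emb a m) (emb b n).
  by move=> *; apply/le'E.
have le'dom x : le' x x -> exists a m, x = emb a m /\ dom a m.
  by move=> [a [m [_ [_ [xE _ dx _ _]]]]]; exists a, m.
have old x : le x x -> dom x false by [].
have new x : A x -> dom x true by move=> Ax; split=> [|_ //]; exact: Adom.
have ext : end_extension le le'.
  move=> y yy x; split=> [|xy].
    move=> [a [m [b [n [-> yE da db [ab mn]]]]]].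
    have [yb n0] := embI y false b n (old _ yy) db yE.
    by move: mn ab; rewrite -n0 -yb; case: m {da} => // /(_ isT).
  by have [xx _] := lo_dom lo xy; apply: (domle x false y false) => //; exact: old.
have ledom x z : le x z -> le x x by case/(lo_dom lo).
exists le'; split => //; last first.
  exists (g o); last exact: gnew.
  by apply: (domle o true o true) => //; exact: new.
split.
- move=> x y [a [m [b [n [-> -> da db [ab mn]]]]]].
  by split; apply: domle => //; [case: da|case: db].
- move=> x y [a [m [b [n [-> -> da db [ab mn]]]]]] /le'E[]// ba nm.
  by rewrite (lo_anti lo ab ba); congr emb; apply/idP/idP.
- move=> y x z xy [a [m [b [n [yE -> da db [ab mn]]]]]].
  move: xy; rewrite yE => -[c [k [a' [m' [-> /embI aE dc da' [ca' km']]]]]].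
  have [aa' mm'] := aE da da'; subst a' m'.
  by apply: domle => //; [exact: (lo_trans lo ca' ab)|move/km'/mn].
- move=> x /le'dom[a [m [-> da]]].
  by apply: (domle o false a m) => //; apply: (lo_bot lo); case: da.
- move=> y; have [yy|nyy] := pselect (le' y y); last first.
    apply: sub_finite_set (finite_set0 _) => x.
    move=> [a [m [b [n [_ yE _ db _]]]]]; apply: nyy; rewrite yE.
    by apply: domle => //; case: db.
  have [b [n [-> db]]] := le'dom _ yy.
  apply: (@sub_finite_set _ _ ((emb^~ false) @` [set x | le x b] `|`
      (emb^~ true) @` [set x | le x b])).
    move=> x [a [m [b' [n' [-> bE da db' [ab' _]]]]]].
    have [bb' _] := embI _ _ _ _ db db' bE; subst b'.
    by case: m {da} => /=; [right|left]; exists a.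
  by rewrite finite_setU; split; exact/finite_image/(lo_fin lo).
- move=> x y /le'dom[a [m [-> da]]] /le'dom[b [n [-> db]]].
  have [c [ca cb cmax]] := lo_meet lo da.1 db.1.
  have dc : dom c (m && n).
    split; first exact: ledom ca.
    by move=> /andP[mT nT]; apply: (Ameet a b); [exact: da.2|exact: db.2|..].
  exists (emb c (m && n)); split.
  + by apply: domle => // /andP[].
  + by apply: domle => // /andP[].
  + move=> z za; have /le'dom[e [k [zE de]]] : le' z z.
      by case: za => [e [k [_ [_ [-> _ de _ _]]]]]; apply: domle => //; case: de.
    move: za; rewrite zE => /le'E[]// ea km /le'E[]// eb kn.
    by apply: domle => //; [exact: cmax|move=> kT; rewrite km ?kn].
- move=> x y /le'dom[a [m [-> da]]] /le'dom[b [n [-> db]]].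
  have [u [au bu]] := lo_dir lo da.1 db.1.
  have [v Av uv] := Acof u (lo_dom lo au).2.
  exists (emb v true); split; apply: domle => //; try exact: new.
    exact: lo_trans uv.
  exact: lo_trans uv.
- move=> y; have [yy|nyy] := pselect (le' y y); last first.
    exists y, y, y => x [xy _ _]; case: nyy.
    move: xy => [a [m [b [n [_ yE _ db _]]]]]; rewrite yE.
    by apply: domle => //; case: db.
  have [b [n [yE db]]] := le'dom _ yy.
  case: n => [|] in yE db *; last first.
    have [a1 [a2 [a3 abc]]] := lo_cover lo b; exists a1, a2, a3 => x xy.
    apply: abc; rewrite yE /= in xy.
    by apply/(rel_cover_end_extension ledom ext) => //; case: db.
  have [bb /(_ isT) Ab] := db.
  have [a1 [a2 a12]] := Acov b Ab; exists (emb a1 true), (emb a2 true), (emb b false).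
  move=> x [xy nxy xymax].
  have [a [m [xE da]]] : exists a m, x = emb a m /\ dom a m.
    by case: xy => [a [m [_ [_ [-> _ da _ _]]]]]; exists a, m.
  subst x y; have [ab _] := (le'E _ _ _ _ da db).1 xy.
  case: m => [|] in da xy nxy xymax *.
    have Aa := da.2 isT; suff [->|->] : a = a1 \/ a = a2 by [constructor 1|constructor 2].
    apply: a12 => //; first by move=> abE; apply: nxy; rewrite abE.
    move=> z Az az zb; have dz := new _ Az.
    have [||/embI[]// ->|/embI[]// ->] := xymax (emb z true); [| |by left|by right].
      exact: domle.
    exact: domle.
  constructor 3; have dbf := old _ bb.
  have [||<-//|/embI[]//] := xymax (emb b false).
    exact: domle.
  exact: domle.
- move=> x y yx atm.
  have [b [n [a [m [yE xE db da [ba nm]]]]]] := yx; subst x y.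
  have nE : n = m.
    apply/idP/idP => // mT.
    have : le' (emb o true) (emb b n).
      apply: atm; last first.
        by apply: (domle o true a m (new _ Ao) da) => //; apply: (lo_bot lo); case: da.
      split.
      + by apply: (domle o false o true) => //; exact: new.
      + by move=> /= oE; apply: (gnew o Ao); rewrite -oE.
      + move=> z _ zo; have [c [k [_ [_ [zE _ dc _ _]]]]] := zo; subst z.
        have [co _] := (le'E _ _ _ _ dc (new _ Ao)).1 zo.
        have -> : c = o by apply: (lo_anti lo co); apply: (lo_bot lo); case: dc.
        by case: k {dc zo}; [right|left].
    by move/(le'E _ _ _ _ (new _ Ao) db) => [_]; apply.
  rewrite nE; congr emb; apply: (lo_atom lo ba) => p op pa.
  have pp := ledom _ _ pa.
  have : le' (emb p false) (emb b n).
    apply: atm; last by apply: domle => //; exact: old.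
    exact/(rel_cover_end_extension ledom ext).
  by move/(le'E _ _ _ _ (old _ pp) db) => [].
- exact/ext.
Qed.

End LadderOrders.

(** * The lattice of a ladder order *)

Lemma ladder_order_join T (o : T) le x y : ladder_order o le -> le x x -> le y y ->
  exists j, [/\ le x j, le y j & forall z, le x z -> le y z -> le j z].
Proof.
elim/Peq: T => T in o le x y * => lo xx yy.
have [u [xu yu]] := lo_dir lo xx yy.
have meets (s : seq T) : (forall z, z \in s -> le x z /\ le y z) ->
    exists m, [/\ le x m, le y m & forall z, z \in s -> le m z].
  elim: s => [|z s IH] sub; first by exists u.
  have [|m [xm ym ms]] := IH; first by move=> v vs; apply: sub; rewrite inE vs orbT.
  have [xz yz] := sub z (mem_head _ _).
  have [n [nm nz nmax]] := lo_meet lo (lo_dom lo xm).2 (lo_dom lo xz).2.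
  exists n; split; [exact: nmax|exact: nmax|].
  by move=> v; rewrite inE => /orP[/eqP ->//|/ms]; exact: (lo_trans lo nm).
have /finite_seqP[s sE] : finite_set [set z | le z u /\ le x z /\ le y z].
  by apply: sub_finite_set (lo_fin lo u) => z [].
have [z zs|m [xm ym ms]] := meets s.
  by have : [set` s] z by []; rewrite -sE => -[].
exists m; split=> // z xz yz.
have [n [nu nz nmax]] := lo_meet lo (lo_dom lo xu).2 (lo_dom lo xz).2.
apply: (lo_trans lo _ nz); apply: ms.
suff : [set` s] n by [].
by rewrite -sE; split => //; split; apply: nmax.
Qed.

Definition ladder_carrier T (o : T) le (lo : ladder_order o le) := {x | le x x}.

Section LadderLattice.
Variables (T : Type) (o : T) (le : T -> T -> Prop) (lo : ladder_order o le).
Local Notation L := (ladder_carrier lo).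
HB.instance Definition _ := gen_eqMixin L.
HB.instance Definition _ := gen_choiceMixin L.
Definition in_ladder x (xx : le x x) : L := exist (fun x => le x x) x xx.

Lemma ladder_sval_inj (x y : L) : sval x = sval y -> x = y.
Proof. by case: x y => [x xx] [y yy]; exact: eq_exist. Qed.

Let leL (x y : L) : bool := `[< le (sval x) (sval y) >].

Let leL_refl : reflexive leL. Proof. by move=> x; apply/asboolP; exact: svalP x. Qed.

Let leL_anti : antisymmetric leL.
Proof.
move=> [x xx] [y yy] /andP[/asboolP xy /asboolP yx].
by apply: eq_exist; exact: (lo_anti lo xy yx).
Qed.

Let leL_trans : transitive leL.
Proof.
by move=> y x z /asboolP xy /asboolP yz; apply/asboolP; exact: (lo_trans lo xy yz).
Qed.

HB.instance Definition _ := Order.Le_isPOrder.Build (Order.Disp tt tt) L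
  leL_refl leL_anti leL_trans.

Lemma ladder_leP (x y : L) : reflect (le (sval x) (sval y)) (x <= y)%O.
Proof. exact: asboolP. Qed.

Let meet_ex (xy : L * L) : exists m : L, forall z : L,
  (z <= m)%O = (z <= xy.1)%O && (z <= xy.2)%O.
Proof.
case: xy => x y /=; have [m [mx my mmax]] := lo_meet lo (svalP x) (svalP y).
exists (in_ladder (lo_dom lo mx).1) => z.
apply/ladder_leP/andP => /= [zm|[/ladder_leP zx /ladder_leP zy]]; last exact: mmax.
by split; apply/ladder_leP; exact: (lo_trans lo zm).
Qed.

Let join_ex (xy : L * L) : exists j : L, forall z : L,
  (j <= z)%O = (xy.1 <= z)%O && (xy.2 <= z)%O.
Proof.
case: xy => x y /=; have [j [xj yj jmin]] := ladder_order_join lo (svalP x) (svalP y).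
exists (in_ladder (lo_dom lo xj).2) => z.
apply/ladder_leP/andP => /= [jz|[/ladder_leP xz /ladder_leP yz]]; last exact: jmin.
by split; apply/ladder_leP; exact: (lo_trans lo _ jz).
Qed.

Let meetP (x y z : L) : (x <= sval (cid (meet_ex (y, z))))%O = (x <= y)%O && (x <= z)%O.
Proof. by case: cid => m /= ->. Qed.

Let joinP (x y z : L) : (sval (cid (join_ex (x, y))) <= z)%O = (x <= z)%O && (y <= z)%O.
Proof. by case: cid => m /= ->. Qed.

HB.instance Definition _ :=
  Order.POrder_MeetJoin_isLattice.Build (Order.Disp tt tt) L meetP joinP.

Let bot : L := in_ladder (lo_oo lo).

Let bot_le (x : L) : (bot <= x)%O.
Proof. by apply/ladder_leP; exact: (lo_bot lo (svalP x)). Qed.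

HB.instance Definition _ := Order.hasBottom.Build (Order.Disp tt tt) L bot_le.

Lemma ladder_ltP (x y : L) : (x < y)%O <-> le (sval x) (sval y) /\ sval x <> sval y.
Proof.
rewrite Order.POrderTheory.lt_neqAle; split=> [/andP[/eqP nxy /ladder_leP xy]|[xy nxy]].
  split => // xyE; apply: nxy; exact: ladder_sval_inj.
by apply/andP; split; [apply/eqP => xyE; apply: nxy; rewrite xyE|exact/ladder_leP].
Qed.

Lemma ladder_coverP (x y : L) : lower_cover x y <-> rel_cover le (sval x) (sval y).
Proof.
split=> [[/ladder_ltP[xy nxy] nz]|[xy nxy xymax]].
  split=> // z xz zy; apply: contrapT => /not_orP[zx zy']; apply: nz.
  exists (in_ladder (lo_dom lo xz).2).
  by split; apply/ladder_ltP; split => //= /esym.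
split; first exact/ladder_ltP.
move=> [z [/ladder_ltP[xz nxz] /ladder_ltP[zy nzy]]].
by have [/esym|] := xymax _ xz zy.
Qed.

Lemma ladder_lower_finite : lower_finite L.
Proof.
move=> x; apply: card_le_finite (lo_fin lo (sval x)).
apply: (@fun_card_le _ _ _ _ sval) => [y /ladder_leP //|y z _ _].
exact: ladder_sval_inj.
Qed.

End LadderLattice.

(** * Maximal ladder orders *)

Lemma ladder_is_ladder T (o : T) le (lo : ladder_order o le) :
  is_ladder 3 (ladder_carrier lo).
Proof.
split; [by exists (in_ladder lo (lo_oo lo))|exact: ladder_lower_finite|move=> y].
have [a [b [c abc]]] := lo_cover lo (sval y).
pose f (x : ladder_carrier lo) :=
  if pselect (sval x = a) then 0 else if pselect (sval x = b) then 1 else 2.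
apply: (@fun_card_le _ _ _ _ f) => [x _|x z].
  by rewrite /f /=; case: pselect => //; case: pselect.
move=> /set_mem/ladder_coverP/abc xabc /set_mem/ladder_coverP/abc zabc fxz.
apply: ladder_sval_inj; move: xabc zabc fxz; rewrite /f.
case: (pselect (sval x = a)) => ?; case: (pselect (sval x = b)) => ?;
case: (pselect (sval z = a)) => ?; case: (pselect (sval z = b)) => ? /=;
by move=> [] ? [] ? ?; congruence.
Qed.

Lemma ladder_atomistic T (o : T) le (lo : ladder_order o le) :
  atomistic (ladder_carrier lo).
Proof.
move=> x; exists [set p | is_atom p /\ (p <= x)%O]; split; first by move=> p [].
split=> [p []//|b ub].
have /ladder_leP mx : (Order.meet x b <= x)%O by exact: leIl.
have <- : Order.meet x b = x; last exact: leIr.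
have E : sval (Order.meet x b) = sval x.
  apply: (lo_atom lo mx) => p op px.
  pose q := in_ladder lo (lo_dom lo px).1.
  have qx : (q <= x)%O by apply/ladder_leP.
  have /ladder_leP // : (q <= Order.meet x b)%O.
  by rewrite lexI qx ub //; split => //; apply/ladder_coverP.
exact: ladder_sval_inj E.
Qed.

Lemma ladder_order_grow T1 (lt1 : T1 -> T1 -> Prop) T2 (o : T2) le :
  MA_aleph1_precaliber_aleph1 ->
  strict_well_order lt1 -> (forall v, countable [set w | lt1 w v]) ->
  ~ countable [set: T1] -> has_card_aleph 1 [set: T1] ->
  ~ ([set: T2] #<= [set: T1]) ->
  ladder_order o le -> [set x | le x x] #<= [set: T1] ->
  exists le', [/\ ladder_order o le', end_extension le le' &
    exists2 x, le' x x & ~ le x x].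
Proof.
move=> MA wo1 seg1 unc1 T1_1 T2T1 lo DT1.
pose L := ladder_carrier lo; have finL := @ladder_lower_finite _ _ _ lo.
have LT1 : [set: L] #<= [set: T1].
  apply: (card_le_trans _ DT1); apply: (@fun_card_le _ _ _ _ sval) => [x _|x y _ _].
    exact: (svalP x).
  exact: (@ladder_sval_inj _ _ _ lo).
have [F filF] := filtration_exists finL wo1 seg1 unc1 LT1.
have [|A [A0 Ameet Acof Acov]] := cofinal_meet_subsemilattice finL filF MA.
  by exists T1, [set: T1].
have DTc : [set x | le x x] #<= ~` [set x | le x x].
  apply: (card_le_trans DT1); apply: (strict_well_order_embed wo1 seg1).
  exact: complement_uncountable wo1 seg1 unc1 T2T1 DT1.
have [g gnew gI] := card_le_fun o DTc.
have AD x : (sval @` A) x -> le x x by move=> [y _ <-]; exact: (svalP y).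
apply: (@ladder_order_extend _ _ _ (sval @` A) g) => //.
- by exists \bot%O.
- move=> _ _ m [x Ax <-] [y Ay <-] mx my mmax.
  exists (Order.meet x y); first exact: Ameet.
  apply: (lo_anti lo); last first.
    have /ladder_leP // : (in_ladder lo (lo_dom lo mx).1 <= Order.meet x y)%O.
    by rewrite lexI; apply/andP; split; apply/ladder_leP.
  by apply: mmax; [exact/ladder_leP/leIl|exact/ladder_leP/leIr].
- move=> x xx; have [y Ay /ladder_leP xy] := Acof (in_ladder lo xx).
  by exists (sval y) => //; exists y.
- move=> _ [y Ay <-]; have [a [b ab]] := Acov y Ay.
  exists (sval a), (sval b) => _ [c Ac <-] cy ncy cmax.
  suff [->|->] : c = a \/ c = b by [left|right].
  apply: ab; split => //; first exact/ladder_ltP.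
  move=> z Az /ladder_ltP[cz ncz] /ladder_ltP[zy nzy].
  by have [|/esym/ncz|/nzy] := cmax (sval z) _ cz zy; first by exists z.
- by move=> a b /AD aa /AD bb; apply: gI; rewrite inE.
- by move=> a /AD; exact: gnew.
Qed.

Theorem theorem7p9 :
  MA_aleph1_precaliber_aleph1 ->
  exists (d : Order.disp_t) (L : bLatticeType d),
    [/\ is_ladder 3 L, atomistic L & has_card_aleph 2 [set: L]%classic].
Proof.
move=> MA.
have [T1 [T2 [lt1 [lt2 [wo1 wo2 seg1 unc1 [T1_1 seg2 T2T1 T2_2]]]]]] := aleph1_aleph2_exist.
have [o _] : [set: T2] !=set0.
  by apply/set0P/negP => /eqP T0; apply: T2T1; rewrite T0; exact: card_ge0.
pose S := {le : T2 -> T2 -> Prop | ladder_order o le}.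
pose R (l l' : S) : bool := `[< end_extension (sval l) (sval l') >].
have ext_dom le le' x : end_extension le le' -> le x x -> le' x x.
  by move=> ext xx; apply/ext.
have [[le lo] lemax] : exists l : S, forall l', R l l' -> l' = l.
  apply: Zorn.
  - by move=> l; apply/asboolP.
  - move=> l1 l2 l3 /asboolP l12 /asboolP l23; apply/asboolP => y yy x.
    split=> [xy|xy]; first by apply/(l12 _ yy)/l23 => //; exact: ext_dom yy.
    by apply/l23; [exact: ext_dom yy|exact/l12].
  - move=> [l1 lo1] [l2 lo2] /asboolP l12 /asboolP l21; apply: eq_exist.
    apply/funext => x; apply/funext => y; apply/propext; split=> /= xy.
      by apply/(l12 y) => //; have [] := lo_dom lo1 xy.
    by apply/(l21 y) => //; have [] := lo_dom lo2 xy.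
  - move=> C Ctot; have [C0|Cn0] := pselect (C !=set0); last first.
      exists (exist _ _ (ladder_order_bot o)) => l Cl; by case: Cn0; exists l.
    have [|||loC extC] := @ladder_order_union _ o (sval @` C).
    + by case: C0 => l Cl; exists (sval l), l.
    + by move=> _ [l _ <-]; exact: svalP.
    + move=> _ _ [l Cl <-] [l' Cl' <-].
      by have [/asboolP|/asboolP] := Ctot _ _ Cl Cl'; [left|right].
    + exists (exist _ _ loC) => l Cl; apply/asboolP; apply: extC; by exists l.
have DT1 : ~ ([set x | le x x] #<= [set: T1]).
  move=> DT1.
  have [le' [lo' ext [x xx' nxx]]] := ladder_order_grow MA wo1 seg1 unc1 T1_1 T2T1 lo DT1.
  have /(congr1 sval)/= E : exist _ le' lo' = exist _ le lo :> S.
    by apply: lemax; apply/asboolP.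
  by apply: nxx; rewrite -E.
exists (Order.Disp tt tt), (ladder_carrier lo); split.
- exact: ladder_is_ladder.
- exact: ladder_atomistic.
apply: has_card_aleph_eq T2_2.
have LD : [set: ladder_carrier lo] #= [set x | le x x].
  have -> : [set x | le x x] = sval @` [set: ladder_carrier lo].
    by apply/seteqP; split=> [x xx|_ [x _ <-]]; [exists (in_ladder lo xx)|exact: (svalP x)].
  by rewrite card_eq_sym; apply: inj_card_eq => x y _ _; exact: ladder_sval_inj.
rewrite (card_eqr LD) card_eq_le card_leT andbT.
exact: (strict_well_order_embed wo2 seg2).
Qed.
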